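(* Let $X$ be a metric space and let $\mu$ be a finite positive regular Borel measure on $X$. Then there exists a bounded continuous real-valued function $f$ on $X$ such that, for all $1\leq p<\infty$, the set of polynomials in $f$, $\{P\circ f : P \text{ a polynomial in one variable}\}$, is dense in $L^p(\mu)$ (the same $f$ works for all $p$).
   Context: $L^p(\mu)$ denotes the usual space of (equivalence classes of) complex-valued $p$-integrable functions with its norm topology, and polynomials have complex coefficients (a constant term is allowed). A positive Borel measure $\mu$ on $X$ is regular if for every Borel set $E\subset X$ one has both $\mu(E)=\sup\{\mu(K): K\subset E,\ K \text{ compact}\}$ and $\mu(E)=\inf\{\mu(U): U\supset E,\ U\text{ open}\}$. *)

(* Defs.v *)
From HB Require Import structures.
From mathcomp Require Import all_boot all_order all_algebra.
From mathcomp Require Import all_classical all_reals all_analysis.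
From mathcomp Require Import measurable_realfun.
From mathcomp Require Export complex.

Set Implicit Arguments.
Unset Strict Implicit.
Unset Printing Implicit Defensive.
Import Order.TTheory GRing.Theory Num.Theory.
Import numFieldNormedType.Exports.
Local Open Scope classical_set_scope.
Local Open Scope ring_scope.

(* The base point is only there because every [measurableType] is pointed; it
   amounts to nonemptiness. *)
#[short(type="pointedMetricType")]
HB.structure Definition PointedMetric (K : numDomainType) :=
  {M of Pointed M & Metric K M}.

Notation borel X := (g_sigma_algebraType (@open X)).

Section regular.
Context {R : realType} {X : pointedMetricType R}.

Definition regular_measure (mu : set (borel X) -> \bar R) : Prop :=
  forall E : set X, measurable (E : set (borel X)) ->
    mu E = ereal_sup [set mu K | K in [set K : set X | compact K /\ K `<=` E]]
    /\
    mu E = ereal_inf [set mu U | U in [set U : set X | open U /\ E `<=` U]].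

End regular.

(* The sigma-algebra on R[i] is the one transported from R * R, i.e. the Borel
   sigma-algebra of the plane. *)
Definition ReIm (R : realType) (z : R[i]) : R * R :=
  (complex.Re z, complex.Im z).

HB.instance Definition _ (R : realType) := isPointed.Build R[i] (0 : R[i]).
HB.instance Definition _ (R : realType) :=
  Measurable.copy R[i] (g_sigma_algebra_preimageType (@ReIm R)).

Section complex_measurability.
Context d (T : measurableType d) (R : realType).

Lemma measurable_ReIm : measurable_fun [set: R[i]] (@ReIm R).
Proof. by move=> _ B mB; exists B. Qed.

Lemma measurable_complexP (f : T -> R[i]) :
  measurable_fun setT f <->
  measurable_fun setT (fun x => complex.Re (f x)) /\
  measurable_fun setT (fun x => complex.Im (f x)).
Proof.
split=> [mf|[mr mi]].
  have mg : measurable_fun setT (@ReIm R \o f).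
    exact: (measurableT_comp measurable_ReIm).
  by split; [exact: (measurableT_comp measurable_fst mg)
            |exact: (measurableT_comp measurable_snd mg)].
have mg : measurable_fun setT (@ReIm R \o f) by exact/measurable_fun_pairP.
move=> _ _ [B mB <-]; have := mg measurableT B mB.
by rewrite !setTI.
Qed.

Lemma measurable_normc_sub (f g : T -> R[i]) :
  measurable_fun setT f -> measurable_fun setT g ->
  measurable_fun setT (fun x => Normc.normc (f x - g x)).
Proof.
move=> /measurable_complexP[fr fi] /measurable_complexP[gr gi].
rewrite (_ : (fun x => _) = fun x =>
  Num.sqrt ((complex.Re (f x) - complex.Re (g x)) ^+ 2
          + (complex.Im (f x) - complex.Im (g x)) ^+ 2)); last first.
  by apply/funext => x; case: (f x) => a b; case: (g x) => a' b'.
apply: (measurableT_comp (continuous_measurable_fun (@sqrt_continuous R))).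
by apply: measurable_funD; apply: measurable_funX; exact: measurable_funB.
Qed.

End complex_measurability.

Section complex_Lp.
Context d (T : measurableType d) (R : realType).
Variable mu : {measure set T -> \bar R}.

(* [LspaceType] only covers real-valued functions. *)
Record complexLp (p : R) (p1 : 1 <= p) := ComplexLp {
  complexLp_val :> {mfun_ mu, T >-> R[i]} ;
  complexLp_finite :
    `[< ('N[mu]_p%:E[(fun x => (Normc.normc (complexLp_val x))%:E)] < +oo)%E >] }.

Lemma le_Lnorm (p : R) (f g : T -> R) : 0 < p ->
  measurable_fun setT f -> measurable_fun setT g ->
  (forall x, 0 <= f x <= g x) ->
  ('N[mu]_p%:E[EFin \o f] <= 'N[mu]_p%:E[EFin \o g])%E.
Proof.
move=> p0 mf mg fg; rewrite unlock.
have mpow (h : T -> R) : measurable_fun setT h ->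
    measurable_fun setT (fun x => `|(EFin \o h) x| `^ p)%E.
  move=> mh; apply: (measurableT_comp (measurable_poweR _)).
  by apply: measurableT_comp => //; exact/measurable_EFinP.
apply: gt0_ler_poweR.
- by rewrite invr_ge0 ltW.
- by rewrite in_itv/= leey andbT integral_ge0// => x _; exact: poweR_ge0.
- by rewrite in_itv/= leey andbT integral_ge0// => x _; exact: poweR_ge0.
apply: ge0_le_integral => //; [|exact: mpow|exact: mpow|move=> x _].
  by move=> x _; exact: poweR_ge0.
have /andP[f0 fgx] := fg x.
apply: gt0_ler_poweR; rewrite ?(ltW p0) ?in_itv/= ?leey ?andbT ?lee_fin//.
by rewrite !ger0_norm// (le_trans f0).
Qed.

Section metric.
Variables (p : R) (p1 : 1 <= p).
Notation Lp := (complexLp p1).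

HB.instance Definition _ := [isSub for @complexLp_val p p1].
HB.instance Definition _ := [Choice of Lp by <:].

Definition Lp_edist (u v : T -> R[i]) : \bar R :=
  'N[mu]_p%:E[(fun x => (Normc.normc (u x - v x))%:E)]%E.

Let p_gt0 : 0 < p. Proof. exact: lt_le_trans p1. Qed.

Let normc_ge0 (z : R[i]) : 0 <= Normc.normc z.
Proof. by case: z => a b; exact: sqrtr_ge0. Qed.

Lemma Lp_edist_sym u v : Lp_edist u v = Lp_edist v u.
Proof.
apply: eq_Lnorm => x; congr EFin.
by rewrite -normcN; congr Normc.normc; exact: opprB.
Qed.

Lemma Lp_edist_triangle (v u w : T -> R[i]) :
  measurable_fun setT u -> measurable_fun setT v -> measurable_fun setT w ->
  (Lp_edist u w <= Lp_edist u v + Lp_edist v w)%E.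
Proof.
move=> mu' mv mw.
have muv := measurable_normc_sub mu' mv; have mvw := measurable_normc_sub mv mw.
apply: le_trans (minkowski_EFin mu muv mvw p1).
apply: le_Lnorm => //; [exact: measurable_normc_sub|exact: measurable_funD|].
move=> x; rewrite normc_ge0/=.
have -> : u x - w x = (u x - v x) + (v x - w x) by rewrite addrA subrK.
exact: le_normcD.
Qed.

Let mLp (u : Lp) : measurable_fun setT (u : T -> R[i]).
Proof. exact: measurable_funPT. Qed.

Lemma Lp_edist_lty (u v : Lp) : (Lp_edist u v < +oo)%E.
Proof.
have mc : measurable_fun setT (cst 0 : T -> R[i]) by exact: measurable_cst.
apply: le_lt_trans (Lp_edist_triangle (mLp u) mc (mLp v)) _.
rewrite [X in (_ + X)%E]Lp_edist_sym; apply: lte_add_pinfty.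
- have /asboolP := complexLp_finite u.
  by congr (_ < _)%E; apply: eq_Lnorm => x; rewrite subr0.
- have /asboolP := complexLp_finite v.
  by congr (_ < _)%E; apply: eq_Lnorm => x; rewrite subr0.
Qed.

Definition Lp_dist (u v : Lp) : R := fine (Lp_edist u v).

Let LpE u v : (Lp_dist u v)%:E = Lp_edist u v.
Proof. by rewrite fineK// ge0_fin_numE ?Lnorm_ge0 ?Lp_edist_lty. Qed.

Lemma Lp_distxx u : Lp_dist u u = 0.
Proof.
apply: EFin_inj; rewrite LpE -[RHS](@Lnorm0 _ _ _ mu p%:E) ?eqe ?gt_eqF//.
by apply: eq_Lnorm => x; rewrite subrr Normc.normc0.
Qed.

Lemma Lp_dist_positivity u v : Lp_dist u v = 0 -> u = v.
Proof.
move=> duv; have uv0 : Lp_edist u v = 0%E by rewrite -LpE duv.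
apply: val_inj.
have muv := measurable_normc_sub (mLp u) (mLp v).
have := Lnorm_eq0_eq0 ((measurable_EFinP _ _).2 muv) _ uv0.
rewrite lte_fin => /(_ p_gt0) uv.
rewrite -[val u]reprK -[val v]reprK; apply/eqmodP/asboolP.
apply: filterS uv => x /= /[apply] -[] /Normc.eq0_normc /eqP.
by rewrite subr_eq0 => /eqP.
Qed.

Lemma Lp_dist_sym u v : Lp_dist u v = Lp_dist v u.
Proof. by rewrite /Lp_dist Lp_edist_sym. Qed.

Lemma Lp_dist_triangle v u w : Lp_dist u w <= Lp_dist u v + Lp_dist v w.
Proof. by rewrite -lee_fin EFinD !LpE Lp_edist_triangle. Qed.

HB.instance Definition _ := isMetric.Build R Lp
  Lp_distxx Lp_dist_positivity Lp_dist_sym Lp_dist_triangle.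

End metric.
End complex_Lp.

Section polynomials.
Context d (T : measurableType d) (R : realType).
Variables (mu : {measure set T -> \bar R}) (p : R) (p1 : 1 <= p).

(* The classes in L^p(mu) of the functions P \o f; [x%:C] embeds R in R[i]. *)
Definition polynomials_in (f : T -> R) : set (complexLp mu p1) :=
  [set u | exists P : {poly R[i]},
    {ae mu, forall x, (u : T -> R[i]) x = P.[((f x)%:C)%C]}].

End polynomials.

Arguments polynomials_in {d T R} mu {p} p1 f.

(* Main.v *)
Require Import Defs.
From HB Require Import structures.
From mathcomp Require Import all_boot all_order all_algebra.
From mathcomp Require Import all_classical all_reals all_analysis.
From mathcomp Require Import complex.
From mathcomp Require Import measurable_realfun.
From mathcomp Require Import ring lra.
Set Implicit Arguments.
Unset Strict Implicit.
Unset Printing Implicit Defensive.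
Import Order.TTheory GRing.Theory Num.Theory.
Import numFieldNormedType.Exports.
Local Open Scope classical_set_scope.
Local Open Scope ring_scope.

(** Polynomials in [f] are dense in every [L^p(mu)] as soon as [f] determines
    the points of [X] up to null sets, in the following sense: every Borel set
    [E] is approximated by functions of [f], that is, for every [e > 0] there is
    a Lipschitz [phi] with [phi \o f] within [e] of the indicator of [E] outside
    a set of measure less than [e]. This condition does not mention [p]. It
    passes to bounded measurable functions; a function of [L^p] is close to its
    truncations, a clamped [phi] keeps the error bounded on the small exceptional
    set, and on the bounded range of [f] the function [phi] is uniformly close to
    a polynomial, by Bernstein's proof of the Weierstrass theorem.

    By regularity [mu] is carried by a countable union of compact sets, so
    countably many balls generate the Borel sets up to null sets
    ([countable_ball_cover]). Sets whose indicator is approximated by functions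
    of [f] form a sigma-algebra, hence it is enough that [f] approximates
    countably many continuous functions [g j] with values in [[0, 1]], the
    truncated distances to the centres of these balls.

    Such an [f] encodes all the [g j] at once, at smaller and smaller scales
    ([exists_encoding_function]). Given the approximation [F n] of [f] and a scale
    [w n], round [F n] to the multiples of [w n]. Continuity forbids exact
    rounding, so a continuous staircase is used; by the pigeonhole principle its
    steep parts can be placed so that [F n] meets them only on a set of small
    measure ([quantize]). Then [F n.+1] adds [w n / 4 * g j] to the rounded
    function, and all later modifications are negligible with respect to [w n].
    Outside a small set, [f / w n] is therefore an integer, plus [g j / 4], plus a
    small error, and [g j] is recovered by removing the integer part. Every
    index [j] is treated at infinitely many scales, so that the error of the
    recovery tends to [0]. *)

(** * Lipschitz functions and polynomial approximation *)

Section lipschitz.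
Variable R : realType.
Implicit Types (h : nat -> R) (x a b c : R) (n : nat).

(** The Bernstein polynomial of order [n] with values [h 0, ..., h n], that is,
    the mean of [h] under the binomial law of parameter ['X]. The recursion
    conditions on the first trial, so no binomial coefficient is needed. *)
Fixpoint bernstein n h : {poly R} :=
  if n is m.+1 then 'X * bernstein m (h \o succn) + (1 - 'X) * bernstein m h
  else (h 0%N)%:P.

Lemma bernsteinS n h x : (bernstein n.+1 h).[x] =
  x * (bernstein n (h \o succn)).[x] + (1 - x) * (bernstein n h).[x].
Proof. by rewrite /= hornerD !hornerM hornerD hornerN hornerC hornerX. Qed.

Lemma bernstein_linear n h1 h2 a b x :
  (bernstein n (fun k => a * h1 k + b * h2 k)).[x] =
  a * (bernstein n h1).[x] + b * (bernstein n h2).[x].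
Proof.
elim: n h1 h2 => [|n IHn] h1 h2; first by rewrite /= !hornerC.
rewrite !bernsteinS IHn.
rewrite -[_ \o succn]/(fun k => a * (h1 \o succn) k + b * (h2 \o succn) k) IHn.
ring.
Qed.

Lemma bernstein_cst n c x : (bernstein n (fun=> c)).[x] = c.
Proof.
elim: n => [|n IHn]; first by rewrite /= hornerC.
by rewrite bernsteinS -[_ \o succn]/(fun=> c) IHn; ring.
Qed.

Lemma bernstein_le n h1 h2 x : 0 <= x <= 1 ->
  (forall k, (k <= n)%N -> h1 k <= h2 k) ->
  (bernstein n h1).[x] <= (bernstein n h2).[x].
Proof.
move=> x01; elim: n h1 h2 => [|n IHn] h1 h2 h12.
  by rewrite /= !hornerC h12.
rewrite !bernsteinS; apply: lerD; apply: ler_wpM2l; try lra.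
  by apply: IHn => k kn; exact: h12.
by apply: IHn => k kn; apply: h12; exact: leqW.
Qed.

(** The second moment of a binomial law about an arbitrary centre: letting [c]
    vary makes the induction close. *)
Lemma bernstein_variance n c x :
  (bernstein n (fun k => (k%:R - c) ^+ 2)).[x] =
  (n%:R * x - c) ^+ 2 + n%:R * x * (1 - x).
Proof.
elim: n c => [|n IHn] c; first by rewrite /= hornerC; ring.
rewrite bernsteinS IHn.
have -> : (fun k => (k%:R - c) ^+ 2) \o succn = fun k => (k%:R - (c - 1)) ^+ 2.
  by apply/funext => k /=; rewrite -natr1; ring.
by rewrite IHn -natr1; ring.
Qed.

Definition is_lipschitz (phi : R -> R) :=
  exists2 L, 0 <= L & forall s t, `|phi s - phi t| <= L * `|s - t|.

(** Chebyshev's argument: the deviation of [phi] is dominated by a constant plus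
    a multiple of the squared distance, whose binomial mean is [O(1/n)]. *)
Lemma weierstrass01 phi e : is_lipschitz phi -> 0 < e ->
  exists P : {poly R}, forall x, 0 <= x <= 1 -> `|P.[x] - phi x| <= e.
Proof.
move=> [L L0 lip] e0.
pose n := (Num.trunc (L ^+ 2 / e ^+ 2)).+1.
have n0 : 0 < n%:R :> R by rewrite ltr0n.
have nL : L ^+ 2 / e ^+ 2 <= n%:R by rewrite ltW// truncnS_gt.
pose h k := phi (k%:R / n%:R).
exists (bernstein n h) => x x01.
have e00 : e != 0 by rewrite gt_eqF.
have n00 : n%:R != 0 :> R by rewrite gt_eqF.
pose C := L ^+ 2 / (2 * e * n%:R ^+ 2).
(* [2 a b <= a ^ 2 + b ^ 2] turns the Lipschitz bound into a quadratic one,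
   whose mean is the variance. *)
have quad k : `|h k - phi x| <= 1 * (e / 2) + C * (k%:R - n%:R * x) ^+ 2.
  apply: le_trans (lip _ _) _; rewrite mul1r.
  have -> : C * (k%:R - n%:R * x) ^+ 2 =
      (L * `|k%:R / n%:R - x|) ^+ 2 / (2 * e).
    rewrite exprMn real_normK ?num_real// /C; field.
    by rewrite e00 n00.
  set u := L * _.
  have uE : u = e / 2 + u ^+ 2 / (2 * e) - (u - e) ^+ 2 / (2 * e) by field.
  by rewrite {1}uE gerBl divr_ge0 ?sqr_ge0// mulr_ge0// ltW.
have mean : (bernstein n (fun k =>
    1 * (e / 2) + C * (k%:R - n%:R * x) ^+ 2)).[x] <= e.
  rewrite (bernstein_linear n (fun=> e / 2)) bernstein_cst bernstein_variance.
  have -> : C * ((n%:R * x - n%:R * x) ^+ 2 + n%:R * x * (1 - x)) =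
      L ^+ 2 / e ^+ 2 / n%:R * (e / 2 * (x * (1 - x))).
    by rewrite /C; field; rewrite e00 n00.
  have q1 : L ^+ 2 / e ^+ 2 / n%:R <= 1 by rewrite ler_pdivrMr// mul1r.
  have q0 : 0 <= L ^+ 2 / e ^+ 2 / n%:R by rewrite !divr_ge0 ?sqr_ge0// ltW.
  have r0 : 0 <= x * (1 - x) by nra.
  have r1 : x * (1 - x) <= 1 by nra.
  have : L ^+ 2 / e ^+ 2 / n%:R * (e / 2 * (x * (1 - x))) <= 1 * (e / 2 * 1).
    apply: ler_pM => //; first by rewrite mulr_ge0//; lra.
    by apply: ler_wpM2l => //; lra.
  lra.
rewrite ler_distl; apply/andP; split.
- have : (bernstein n (fun k => 1 * phi x + (- 1) *
      (1 * (e / 2) + C * (k%:R - n%:R * x) ^+ 2))).[x] <= (bernstein n h).[x].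
    apply: bernstein_le => // k _.
    by have := quad k; rewrite ler_distl => /andP[+ _]; lra.
  rewrite (bernstein_linear n (fun=> phi x)) bernstein_cst.
  by move: mean; lra.
- have : (bernstein n h).[x] <= (bernstein n (fun k => 1 * phi x + 1 *
      (1 * (e / 2) + C * (k%:R - n%:R * x) ^+ 2))).[x].
    apply: bernstein_le => // k _.
    by have := quad k; rewrite ler_distl => /andP[_ +]; lra.
  rewrite (bernstein_linear n (fun=> phi x)) bernstein_cst.
  by move: mean; lra.
Qed.

Lemma is_lipschitz_comp phi psi :
  is_lipschitz phi -> is_lipschitz psi -> is_lipschitz (phi \o psi).
Proof.
move=> [L L0 HL] [K K0 HK]; exists (L * K); first exact: mulr_ge0.
move=> s t /=; apply: le_trans (HL _ _) _.
by rewrite -mulrA ler_wpM2l.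
Qed.

Lemma is_lipschitz_affine a b : is_lipschitz (fun t => a * t + b).
Proof.
exists `|a| => // s t; rewrite -normrM.
by rewrite (_ : _ - _ = a * (s - t))//; ring.
Qed.

Lemma is_lipschitzD phi psi : is_lipschitz phi -> is_lipschitz psi ->
  is_lipschitz (fun t => phi t + psi t).
Proof.
move=> [L L0 HL] [K K0 HK]; exists (L + K); first exact: addr_ge0.
move=> s t; rewrite mulrDl opprD addrACA.
by apply: le_trans (ler_normD _ _) _; exact: lerD.
Qed.

Lemma is_lipschitz_continuous phi : is_lipschitz phi -> continuous phi.
Proof.
move=> [L L0 HL] x; apply/cvgrPdist_le => e e0.
have L1 : 0 < L + 1 by lra.
near=> y.
apply: le_trans (HL _ _) _; apply: (@le_trans _ _ ((L + 1) * `|x - y|)).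
  by rewrite ler_wpM2r//; lra.
rewrite mulrC -ler_pdivlMr//; near: y.
by apply: cvgr_dist_le; [exact: cvg_id|exact: divr_gt0].
Unshelve. all: by end_near. Qed.

Lemma weierstrass phi M e : is_lipschitz phi -> 0 < M -> 0 < e ->
  exists P : {poly R}, forall x, `|x| <= M -> `|P.[x] - phi x| <= e.
Proof.
move=> lip M0 e0.
have M00 : M != 0 by rewrite gt_eqF.
have [P PE] := weierstrass01
  (is_lipschitz_comp lip (is_lipschitz_affine (2 * M) (- M))) e0.
exists (P \Po ((2 * M)^-1 *: 'X + (2^-1)%:P)) => x xM.
rewrite horner_comp !hornerE.
have y01 : 0 <= (2 * M)^-1 * x + 2^-1 <= 1.
  have -> : (2 * M)^-1 * x + 2^-1 = (x + M) / (2 * M) by field.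
  move: xM; rewrite ler_norml => /andP[? ?].
  rewrite divr_ge0 ?mulr_ge0 ?ler_pdivrMr ?mulr_gt0//=; lra.
have := PE _ y01; rewrite /= (_ : 2 * M * _ + - M = x)//.
by field.
Qed.

Definition clamp a b t : R := Num.max a (Num.min b t).

Lemma clamp_itv a b t : a <= b -> a <= clamp a b t <= b.
Proof.
by move=> ab; rewrite /clamp le_max lexx ge_max ab ge_min lexx.
Qed.

Lemma clamp_id a b t : a <= t <= b -> clamp a b t = t.
Proof.
rewrite /clamp => /andP[at' tb].
by rewrite min_r// max_r.
Qed.

Lemma clamp_dist a b s t : `|clamp a b s - clamp a b t| <= `|s - t|.
Proof.
have st : s - t <= `|s - t| by exact: ler_norm.
have ts : - (s - t) <= `|s - t| by rewrite -normrN; exact: ler_norm.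
have min_dist : `|Num.min b s - Num.min b t| <= `|s - t|.
  by rewrite ler_norml; case: (leP b s) => ?; case: (leP b t) => ?;
    apply/andP; split; lra.
apply: le_trans min_dist; rewrite /clamp.
move: (Num.min b s) (Num.min b t) => {st ts}s' t'.
have st : s' - t' <= `|s' - t'| by exact: ler_norm.
have ts : - (s' - t') <= `|s' - t'| by rewrite -normrN; exact: ler_norm.
by rewrite ler_norml; case: (leP a s') => ?; case: (leP a t') => ?;
  apply/andP; split; lra.
Qed.

Lemma clamp_remainder M t : 0 <= M -> `|t - clamp (- M) M t| <= `|t|.
Proof.
move=> M0; rewrite /clamp; case: (leP M t) => Mt.
  by rewrite max_r ?ger0_norm//; lra.
case: (leP (- M) t) => tM; first by rewrite subrr normr0.
by rewrite !ler0_norm//; lra.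
Qed.

Lemma is_lipschitz_clamp a b : is_lipschitz (clamp a b).
Proof. by exists 1 => // s t; rewrite mul1r clamp_dist. Qed.

End lipschitz.

(** * A continuous rounding function *)

Section staircase.
Variable R : realType.
Implicit Types (s t : R) (N i : nat) (k : int).

(** Rounding to an integer with a jump spread over a slot of width [1 / N]: it
    rises by one while the fractional part runs from [i / N] to [i.+1 / N], and
    is constant elsewhere. *)
Definition staircase N i t : R :=
  (Num.floor t)%:~R + clamp 0 1 (N%:R * (t - (Num.floor t)%:~R) - i%:R).

Let floorP t : (Num.floor t)%:~R <= t < (Num.floor t)%:~R + 1.
Proof. by have := floor_itv t; rewrite intrD. Qed.

Let clamp01P t : (0 : R) <= clamp 0 1 t <= 1.
Proof. exact: clamp_itv. Qed.

Let clamp01_le0 t : t <= 0 -> clamp 0 1 t = 0.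
Proof. by move=> t0; rewrite /clamp min_r ?max_l//; lra. Qed.

Let clamp01_ge1 t : 1 <= t -> clamp 0 1 t = 1.
Proof. by move=> t0; rewrite /clamp min_l ?max_r//; lra. Qed.

Lemma staircase_dist N i t : `|staircase N i t - t| <= 1.
Proof.
have := floorP t; rewrite /staircase; set c := clamp _ _ _ => /andP[? ?].
have /andP[? ?] : 0 <= c <= 1 := clamp01P _.
by rewrite ler_norml; apply/andP; split; lra.
Qed.

Lemma is_lipschitz_staircase N i : (i < N)%N -> is_lipschitz (staircase N i).
Proof.
move=> iN.
have N1 : 1 <= N%:R :> R by rewrite ler1n (leq_trans _ iN).
have i0 : 0 <= i%:R :> R by rewrite ler0n.
have iN' : i%:R + 1 <= N%:R :> R by rewrite natr1 ler_nat.
exists N%:R => [|s t]; first by lra.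
wlog st : s t / s <= t.
  move=> H; have [/H//|ts] := leP s t.
  by rewrite distrC (distrC s); apply: H; exact: ltW.
rewrite (distrC s) (distrC (staircase _ _ s)).
rewrite [X in _ <= _ * X]ger0_norm; last lra.
have /andP[s1 s2] := floorP s; have /andP[t1 t2] := floorP t.
rewrite /staircase.
have := le_floor st; rewrite le_eqVlt => /predU1P[eq_st|].
  rewrite -eq_st opprD addrACA subrr add0r.
  apply: le_trans (clamp_dist _ _ _ _) _.
  set u := _ - i%:R; set v := _ - i%:R.
  have -> : u - v = N%:R * (t - s) by rewrite /u /v; ring.
  by rewrite ger0_norm// mulr_ge0//; lra.
(* The floors differ: compare [s] and [t] to the integers in between, where the
   clamped term is [1] on the left and [0] on the right. *)
rewrite -lezD1 -(ler_int R) intrD => kl.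
set ks := (Num.floor s)%:~R in s1 s2 kl *.
set kt := (Num.floor t)%:~R in t1 t2 kl *.
have cs : 1 - clamp 0 1 (N%:R * (s - ks) - i%:R) <= N%:R * (ks + 1 - s).
  rewrite -[X in X - _](@clamp01_ge1 (N%:R - i%:R)); last lra.
  apply: le_trans (ler_norm _) _; apply: le_trans (clamp_dist _ _ _ _) _.
  set u := _ - (_ - _).
  have -> : u = N%:R * (ks + 1 - s) by rewrite /u; ring.
  by rewrite ger0_norm// mulr_ge0//; lra.
have ct : clamp 0 1 (N%:R * (t - kt) - i%:R) <= N%:R * (t - kt).
  rewrite -[leLHS]subr0 -[X in _ - X](@clamp01_le0 (- i%:R)); last lra.
  apply: le_trans (ler_norm _) _; apply: le_trans (clamp_dist _ _ _ _) _.
  rewrite opprK subrK.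
  by rewrite ger0_norm// mulr_ge0//; lra.
have ckl : kt - (ks + 1) <= N%:R * (kt - (ks + 1)) by rewrite ler_peMl//; lra.
have /andP[? ?] := clamp01P (N%:R * (s - ks) - i%:R).
have /andP[? ?] := clamp01P (N%:R * (t - kt) - i%:R).
rewrite ger0_norm; last lra.
have -> : N%:R * (t - s) =
  N%:R * (ks + 1 - s) + N%:R * (t - kt) + N%:R * (kt - (ks + 1)) by ring.
lra.
Qed.

Lemma staircase_int N i t : (0 < N)%N ->
  ~ (exists k, k%:~R + i%:R / N%:R < t < k%:~R + i.+1%:R / N%:R) ->
  exists k, staircase N i t = k%:~R.
Proof.
move=> N0 nt; have N0' : 0 < N%:R :> R by rewrite ltr0n.
have [lti|] := leP (t - (Num.floor t)%:~R) (i%:R / N%:R).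
  exists (Num.floor t); rewrite /staircase clamp01_le0 ?addr0//.
  by rewrite subr_le0 mulrC -ler_pdivlMr.
move=> gti; exists (Num.floor t + 1).
rewrite /staircase clamp01_ge1 ?intrD//.
rewrite lerBrDr nat1r mulrC -ler_pdivrMr// leNgt; apply/negP => lti.
by apply: nt; exists (Num.floor t); apply/andP; split; lra.
Qed.

(** With four slots and the jump in the third one, there is room around each
    integer for a payload in [[0, 1/4]] and an error of size [1/4]. *)
Lemma staircase_flat k t : k%:~R - 4^-1 <= t <= k%:~R + 2^-1 ->
  staircase 4 2 t = k%:~R.
Proof.
move=> /andP[t1 t2]; rewrite /staircase.
have [kt|tk] := leP k%:~R t.
  rewrite (_ : Num.floor t = k); last first.
    by apply/floor_def; rewrite intrD; apply/andP; split; lra.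
  by rewrite clamp01_le0 ?addr0//; lra.
rewrite (_ : Num.floor t = k - 1); last first.
  by apply/floor_def; rewrite subrK intrB; apply/andP; split; lra.
by rewrite clamp01_ge1 ?intrB; lra.
Qed.

Definition decoder t : R := 4 * (t - staircase 4 2 t).

Lemma decoderE k (y z : R) : 0 <= y <= 1 -> `|z| <= 4^-1 ->
  decoder (k%:~R + y / 4 + z) = y + 4 * z.
Proof.
rewrite ler_norml => /andP[y0 y1] /andP[z0 z1].
rewrite /decoder (@staircase_flat k); first by field.
by apply/andP; split; lra.
Qed.

Lemma is_lipschitz_decoder : is_lipschitz decoder.
Proof.
have /(is_lipschitz_comp (is_lipschitz_affine (-4) 0)) lip :
  is_lipschitz (staircase 4 2) by exact: is_lipschitz_staircase.
have := is_lipschitzD (is_lipschitz_affine 4 0) lip.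
congr is_lipschitz; apply/funext => t; rewrite /= /decoder; ring.
Qed.

End staircase.

(** * Approximation in measure by functions of [f] *)

Section approximable.
Context d (T : measurableType d) (R : realType).
Variable mu : {finite_measure set T -> \bar R}.

Lemma measure_cvg_empty (F : (set T)^nat) (e : R) : 0 < e ->
  (forall n, measurable (F n)) -> (forall n, F n.+1 `<=` F n) ->
  (forall x, exists n, ~ F n x) ->
  exists n, (mu (F n) < e%:E)%E.
Proof.
move=> e0 mF decF F0.
have F00 : \bigcap_n F n = set0.
  by apply/seteqP; split=> // x Fx; have [n] := F0 x; apply; exact: Fx.
have : mu \o F @ \oo --> mu (\bigcap_n F n).
  apply: nonincreasing_cvg_mu => //.
  - by rewrite ltey_eq fin_num_measure.
  - by rewrite F00.
  - by apply/nonincreasing_seqP => n; apply/subsetPset.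
rewrite F00 measure0 => /(_ [set y | y < e%:E]%E)[].
  apply: open_nbhs_nbhs; split; first exact: open_ereal_lt_ereal.
  by rewrite /= lte_fin.
by move=> n _ muF; exists n; exact: (muF n (leqnn n)).
Qed.

Variable f : T -> R.

(** Approximation in measure by Lipschitz functions of [f], in terms of an
    exceptional set: [h] is then equal almost everywhere to a Borel function of
    [f]. *)
Definition approximable (h : T -> R) := forall e : R, 0 < e ->
  exists phi N, [/\ is_lipschitz phi, measurable N, (mu N < e%:E)%E &
                    forall x, ~ N x -> `|phi (f x) - h x| <= e].

Lemma approximable_cst c : approximable (fun=> c).
Proof.
move=> e e0; exists (fun=> c), set0; split => //.
- by exists 0 => // s t; rewrite subrr normr0 mul0r.
- by rewrite measure0 lte_fin.
- by move=> x _; rewrite subrr normr0 ltW.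
Qed.

Let measureU_lt (A B : set T) (e : R) : measurable A -> measurable B ->
  (mu A < (e / 2)%:E)%E -> (mu B < (e / 2)%:E)%E -> (mu (A `|` B) < e%:E)%E.
Proof.
move=> mA mB muA muB; apply: (@le_lt_trans _ _ (mu A + mu B)%E).
  exact: measureU2.
by rewrite {1}[e]splitr EFinD lteD.
Qed.

Lemma approximable_limit h :
  (forall e : R, 0 < e -> exists g N,
     [/\ approximable g, measurable N, (mu N < e%:E)%E &
         forall x, ~ N x -> `|g x - h x| <= e]) ->
  approximable h.
Proof.
move=> H e e0; have e20 : 0 < e / 2 by rewrite divr_gt0.
have [g [N [ag mN muN gh]]] := H _ e20.
have [phi [M [lphi mM muM fg]]] := ag _ e20.
exists phi, (M `|` N); split => //; [exact: measurableU|exact: measureU_lt|].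
move=> x /not_orP[Mx Nx].
by rewrite [leRHS]splitr (le_trans (ler_distD (g x) _ _))// lerD ?fg ?gh.
Qed.

Lemma approximable_comp chi h : is_lipschitz chi -> approximable h ->
  approximable (chi \o h).
Proof.
move=> lchi ah e e0; have [L L0 Lchi] := lchi.
have L1 : 0 < L + 1 by lra.
have [|phi [N [lphi mN muN phih]]] := ah (e / (L + 1)).
  by rewrite divr_gt0.
have le_e : e / (L + 1) <= e by rewrite ler_pdivrMr// ler_pMr//; lra.
exists (chi \o phi), N; split => //.
- exact: is_lipschitz_comp.
- by apply: lt_le_trans muN _; rewrite lee_fin.
- move=> x Nx; apply: le_trans (Lchi _ _) _.
  apply: (@le_trans _ _ ((L + 1) * (e / (L + 1)))).
    by apply: ler_pM => //; [lra|exact: phih].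
  by rewrite mulrC divfK// gt_eqF.
Qed.

Lemma approximableD g h : approximable g -> approximable h ->
  approximable (fun x => g x + h x).
Proof.
move=> ag ah e e0; have e20 : 0 < e / 2 by rewrite divr_gt0.
have [phi [M [lphi mM muM phig]]] := ag _ e20.
have [psi [N [lpsi mN muN psih]]] := ah _ e20.
exists (fun t => phi t + psi t), (M `|` N); split => //.
- exact: is_lipschitzD.
- exact: measurableU.
- exact: measureU_lt.
- move=> x /not_orP[Mx Nx].
  rewrite [leRHS]splitr opprD addrACA (le_trans (ler_normD _ _))//.
  by rewrite lerD ?phig ?psih.
Qed.

Lemma approximable_affine a b h : approximable h ->
  approximable (fun x => a * h x + b).
Proof. exact: (approximable_comp (is_lipschitz_affine a b)). Qed.

Lemma approximable_sum n (h : nat -> T -> R) :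
  (forall k, approximable (h k)) ->
  approximable (fun x => \sum_(k < n) h k x).
Proof.
move=> ah; elim: n => [|n IHn].
  under eq_fun do rewrite big_ord0; exact: approximable_cst.
by under eq_fun do rewrite big_ord_recr/=; exact: approximableD.
Qed.

(** Steeper and steeper ramps of [h] below the level [r]: they differ from the
    indicator on shrinking strips with empty intersection. *)
Lemma approximable_indic_lt (h : T -> R) r :
  measurable_fun setT h -> approximable h ->
  approximable \1_[set x | h x < r].
Proof.
move=> mh ah; apply: approximable_limit => e e0.
pose N n := h @^-1` `]r - n.+1%:R^-1, r[.
have mN n : measurable (N n).
  by rewrite -[N n]setTI; apply: mh => //; exact: measurable_itv.
have [n muN] : exists n, (mu (N n) < e%:E)%E.
  apply: measure_cvg_empty => //.
  - move=> n x; rewrite /N/= !in_itv/= => /andP[rh ->]; rewrite andbT.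
    apply: le_lt_trans rh.
    by rewrite lerD2l lerN2 lef_pV2 ?posrE// ler_nat.
  - move=> x; exists (Num.trunc (r - h x)^-1).
    rewrite /N/= in_itv/= => /andP[rh hr].
    have rh0 : 0 < r - h x by lra.
    have : (Num.trunc (r - h x)^-1).+1%:R^-1 < r - h x.
      by rewrite -[ltRHS]invrK ltf_pV2 ?posrE ?invr_gt0// truncnS_gt.
    by move: rh; set u := _.+1%:R^-1; lra.
have n0 : 0 < n.+1%:R :> R by rewrite ltr0n.
exists (fun x => clamp 0 1 (n.+1%:R * (r - h x))), (N n); split => //.
- have -> : (fun x => clamp 0 1 (n.+1%:R * (r - h x))) =
      clamp 0 1 \o (fun x => - n.+1%:R * h x + n.+1%:R * r).
    by apply/funext => x /=; congr clamp; ring.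
  apply: approximable_comp; first exact: is_lipschitz_clamp.
  exact: approximable_affine.
- move=> x Nx; rewrite indicE; have [hr|rh] := ltP (h x) r.
    rewrite mem_set// /clamp min_l ?max_r ?subrr ?normr0 ?(ltW e0)//.
    rewrite -ler_pdivrMl// mulr1 leNgt; apply/negP => rh; apply: Nx.
    by rewrite /N/= in_itv/= hr andbT; move: rh; set u := _^-1; lra.
  rewrite memNset; last by apply/negP; rewrite -leNgt.
  have le0 : n.+1%:R * (r - h x) <= 0 by rewrite pmulr_rle0// subr_le0.
  rewrite /clamp min_r ?max_l ?subrr ?normr0 ?(ltW e0)//.
  exact: le_trans le0 _.
Qed.

Definition approximable_set (E : set T) :=
  measurable E /\ approximable \1_E.

Lemma approximable_setU E F : approximable_set E -> approximable_set F ->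
  approximable_set (E `|` F).
Proof.
move=> [mE aE] [mF aF]; split; first exact: measurableU.
have -> : \1_(E `|` F) = clamp 0 1 \o (fun x => \1_E x + \1_F x) :> (T -> R).
  apply/funext => x; rewrite /= !indicE in_setU.
  case: (x \in E); case: (x \in F) => /=.
  - by rewrite /clamp min_l ?max_r//; lra.
  - by rewrite addr0 clamp_id// ler01 lexx.
  - by rewrite add0r clamp_id// ler01 lexx.
  - by rewrite addr0 clamp_id// ler01 lexx.
apply: approximable_comp; first exact: is_lipschitz_clamp.
exact: approximableD.
Qed.

Lemma sigma_algebra_approximable_set : sigma_algebra setT approximable_set.
Proof.
have a0 : approximable_set set0.
  by split => //; rewrite indic0; exact: approximable_cst.
split => //.
- move=> E [mE aE]; rewrite setTD; split; first exact: measurableC.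
  have -> : \1_(~` E) = (fun x => - 1 * \1_E x + 1) :> (T -> R).
    apply/funext => x; rewrite !indicE in_setC.
    by case: (x \in E) => /=; ring.
  exact: approximable_affine.
- move=> E aE; split.
    by apply: bigcup_measurable => n _; have [] := aE n.
  pose S n := \big[setU/set0]_(k < n) E k.
  have aS n : approximable_set (S n).
    by apply: big_ind => // *; exact: approximable_setU.
  have mS n : measurable (S n) by have [] := aS n.
  have mU : measurable (\bigcup_k E k).
    by apply: bigcup_measurable => n _; have [] := aE n.
  apply: approximable_limit => e e0.
  have [n muS] : exists n, (mu (\bigcup_k E k `\` S n) < e%:E)%E.
    apply: measure_cvg_empty => //.
    + by move=> n; exact: measurableD.
    + move=> n; apply: setDS.
      by rewrite /S big_ord_recr/=; exact: subsetUl.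
    + move=> x; have [[k _ Ek]|nE] := pselect ((\bigcup_k E k) x); last first.
        by exists 0%N => -[].
      exists k.+1 => -[_]; apply; rewrite /S big_ord_recr/=; by right.
  exists \1_(S n), (\bigcup_k E k `\` S n); split => //.
  + by have [] := aS n.
  + exact: measurableD.
  + move=> x nx; rewrite !indicE.
    suff -> : (x \in \bigcup_k E k) = (x \in S n) by rewrite subrr normr0 ltW.
    apply/idP/idP; rewrite !inE => xU.
      by apply: contrapT => xS; exact: nx.
    by move: xU; rewrite /S -bigcup_mkord => -[k _ ?]; exists k.
Qed.

Hypothesis indic_approximable : forall E, measurable E -> approximable \1_E.

(* Counting the layers below [t] is rounding [t] down. *)
Let sum_layers n (t : R) : 0 <= t <= n%:R ->
  `|\sum_(k < n) (k.+1%:R <= t)%R%:R - t| <= 1.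
Proof.
elim: n => [|n IHn]; first by rewrite big_ord0 => t0; rewrite ler_norml; lra.
move=> /andP[t0 tn]; rewrite big_ord_recr/=.
have [tn'|nt] := leP t n%:R.
  rewrite (_ : (n.+1%:R <= t) = false) ?addr0 ?IHn ?t0//.
  apply/negbTE; rewrite -ltNge; apply: le_lt_trans tn' _.
  by rewrite ltr_nat.
rewrite (eq_bigr (fun=> 1)) => [|k _]; last first.
  rewrite (_ : _ <= t)//; apply: le_trans (ltW nt).
  by rewrite ler_nat.
rewrite sumr_const card_ord -natr1 in tn *.
by case: (leP _ t) => /= ?; rewrite ler_norml; lra.
Qed.

Lemma approximable01 (h : T -> R) :
  measurable_fun setT h -> (forall x, 0 <= h x <= 1) ->
  approximable h.
Proof.
move=> mh h01; apply: approximable_limit => e e0.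
pose n := (Num.trunc e^-1).+1.
have n0 : 0 < n%:R :> R by rewrite ltr0n.
have nL : n%:R^-1 <= e.
  by rewrite -[leRHS]invrK lef_pV2 ?posrE ?invr_gt0// ltW// truncnS_gt.
exists (fun x => n%:R^-1 * (\sum_(k < n) \1_[set y | k.+1%:R <= n%:R * h y] x)
  + 0), set0; split => //.
- apply: approximable_affine.
  apply: (@approximable_sum n (fun k => \1_[set y | k.+1%:R <= n%:R * h y])) => k.
  apply: indic_approximable; rewrite -[X in measurable X]setTI.
  have mnh : measurable_fun setT (fun y => n%:R * h y).
    by apply: measurable_funM.
  rewrite (_ : [set y | _] = (fun y => n%:R * h y) @^-1` `[k.+1%:R, +oo[).
    apply: mnh => //; exact: measurable_itv.
  by apply/seteqP; split=> y /=; rewrite in_itv/= andbT.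
- by rewrite measure0 lte_fin.
- move=> x _; apply: le_trans nL.
  under eq_bigr do rewrite indicE mem_setE/=.
  rewrite addr0 -[X in _ - X](mulKf (lt0r_neq0 n0)) -mulrBr normrM.
  rewrite ger0_norm ?invr_ge0 ?(ltW n0)// ler_piMr ?invr_ge0 ?(ltW n0)//.
  apply: sum_layers; have := h01 x.
  by move=> /andP[? ?]; rewrite mulr_ge0 ?ler_piMr ?(ltW n0).
Qed.

Lemma approximable_bounded (h : T -> R) M : measurable_fun setT h ->
  (forall x, `|h x| <= M) -> approximable h.
Proof.
move=> mh hM.
pose K := `|M| + 1.
have K0 : 0 < K by rewrite ltr_wpDl.
have hK x : `|h x| <= K.
  by apply: le_trans (hM x) _; apply: le_trans (ler_norm _) _; rewrite lerDl.
have -> : h = fun x => 2 * K * ((h x + K) / (2 * K)) + (- K).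
  by apply/funext => x; field; rewrite gt_eqF.
apply: approximable_affine; apply: approximable01.
  by apply: measurable_funM => //; exact: measurable_funD.
move=> x; have := hK x; rewrite ler_norml => /andP[? ?].
by rewrite divr_ge0 ?ler_pdivrMr ?mulr_gt0//=; lra.
Qed.

End approximable.

(** * Encoding countably many functions into one *)

Section pigeonhole.
Context d (T : measurableType d) (R : realType).
Variable mu : {finite_measure set T -> \bar R}.

Lemma measure_pigeonhole (e : R) : 0 < e -> exists2 n, (0 < n)%N &
  forall B : nat -> set T, (forall i, measurable (B i)) -> trivIset `I_n B ->
  exists2 i, (i < n)%N & (mu (B i) < e%:E)%E.
Proof.
move=> e0; set m := fine (mu setT).
have mE : mu setT = m%:E by rewrite fineK ?fin_num_measure.
exists (Num.trunc (m / e)).+1 => // B mB tB; set n := _.+1 in tB *.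
apply: contrapT => noB.
have Be i : (i < n)%N -> (e%:E <= mu (B i))%E.
  by move=> iN; rewrite leNgt; apply/negP => ?; apply: noB; exists i.
have : (mu (\bigcup_(i in `I_n) B i) <= m%:E)%E.
  by rewrite -mE le_measure ?inE//; apply: bigcup_measurable => i _.
apply/negP; rewrite -ltNge measure_fin_bigcup//.
rewrite -(fsbig_ord _ _ (fun i => mu (B i))).
apply: (@lt_le_trans _ _ (\sum_(i < n) e%:E)%E); last first.
  by apply: lee_sum => i _; exact: Be.
rewrite sumEFin lte_fin sumr_const card_ord -mulr_natl -ltr_pdivrMr//.
exact: truncnS_gt.
Qed.

End pigeonhole.

Section construction.
Context (X : ptopologicalType) (R : realType).
Variable mu : {finite_measure set (borel X) -> \bar R}.

Lemma open_measurable_borel (U : set X) :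
  open U -> measurable (U : set (borel X)).
Proof. by move=> oU; apply: sub_sigma_algebra. Qed.

Lemma continuous_measurable_borel (h : X -> R) :
  continuous h -> measurable_fun setT (h : borel X -> R).
Proof.
move=> /continuousP ch; apply: (measurability _ (RGenOpens.measurableE R)).
move=> _ [_ [a [b ->] <-]]; rewrite setTI.
apply: open_measurable_borel; apply: ch; exact: interval_open.
Qed.

(** Up to a perturbation of size [w], a continuous function takes its values in
    the multiples of [w] outside a set of small measure. The [n] possible
    positions of the jump of the staircase correspond to disjoint exceptional
    sets, so one of them is small. *)
Lemma quantize (F : X -> R) (w e : R) : continuous F -> 0 < w -> 0 < e ->
  exists q (N : set (borel X)),
    [/\ continuous q, measurable N, (mu N < e%:E)%E,
        forall x, `|q x - F x| <= w &
        forall x, ~ N x -> exists k : int, q x = w * k%:~R].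
Proof.
move=> cF w0 e0; have w00 : w != 0 by rewrite gt_eqF.
have [n n0 pigeon] := measure_pigeonhole mu e0.
have n0' : 0 < n%:R :> R by rewrite ltr0n.
have cFw : continuous (fun x => F x / w).
  by move=> x; apply: cvgM; [exact: cF|exact: cvg_cst].
pose B i : set (borel X) := \bigcup_(k : int)
  (fun x => F x / w) @^-1` `]k%:~R + i%:R / n%:R, k%:~R + i.+1%:R / n%:R[.
have mB i : measurable (B i).
  apply: open_measurable_borel; apply: bigcup_open => k _.
  have /continuousP := cFw; apply; exact: interval_open.
have tB : trivIset `I_n B.
  move=> i j; rewrite /mkset => iN jN [x [[k _ xk] [l _ xl]]].
  move: xk xl; rewrite /= !in_itv/=; set t := F x / w => xk xl.
  (* [t] determines its integer part, then the slot of its fractional part. *)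
  have frac m i' : (i' < n)%N ->
      m%:~R + i'%:R / n%:R < t < m%:~R + i'.+1%:R / n%:R ->
      [/\ Num.floor t = m, i'%:R < (t - m%:~R) * n%:R
        & (t - m%:~R) * n%:R < i'.+1%:R].
    move=> i'n /andP[ti it].
    split; [|by rewrite -ltr_pdivrMr// ltrBrDl|by rewrite -ltr_pdivlMr// ltrBlDl].
    apply/floor_def; rewrite intrD.
    have i0 : 0 <= i'%:R / n%:R :> R by rewrite divr_ge0.
    have i1 : i'.+1%:R / n%:R <= 1 :> R.
      by rewrite ler_pdivrMr// mul1r ler_nat.
    by apply/andP; split; lra.
  have [<- ti it] := frac _ _ iN xk; have [lE] := frac _ _ jN xl.
  rewrite -lE => tj jt; apply/eqP; rewrite eqn_leq; apply/andP; split.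
    by rewrite -ltnS -(ltr_nat R) (lt_trans ti jt).
  by rewrite -ltnS -(ltr_nat R) (lt_trans tj it).
have [i iN muB] := pigeon _ mB tB.
exists (fun x => w * staircase n i (F x / w)), (B i); split => //.
- move=> x; apply: cvgM; first exact: cvg_cst.
  apply: (@continuous_comp _ _ _ (fun x => F x / w)); first exact: cFw.
  by apply: is_lipschitz_continuous; exact: is_lipschitz_staircase.
- move=> x; rewrite -[X in _ - X](mulfVK w00) mulrC -mulrBl normrM.
  by rewrite (gtr0_norm w0) ler_piMl ?(ltW w0)// staircase_dist.
- move=> x Bx; have [|k ->] := @staircase_int R n i (F x / w) n0; last by exists k.
  by move=> [k xk]; apply: Bx; exists k => //=; rewrite in_itv.
Qed.

Variable g : nat -> X -> R.
Hypothesis g_continuous : forall j, continuous (g j).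
Hypothesis g01 : forall j x, 0 <= g j x <= 1.

(* The scales decrease faster than any geometric sequence: the modifications
   after stage [n] are [O(w n.+1)], negligible with respect to [w n]. *)
Let w n : R := n.+1`!%:R^-1.

Let w_gt0 n : 0 < w n. Proof. by rewrite invr_gt0 ltr0n fact_gt0. Qed.

Let wS n : w n.+1 = w n / n.+2%:R.
Proof. by rewrite /w factS natrM invfM mulrC. Qed.

Let wS_half n : w n.+1 <= w n / 2.
Proof. by rewrite wS ler_pM2l// lef_pV2 ?posrE// ler_nat. Qed.

(* The function encoded at stage [n]; every index is met infinitely often. *)
Let s n := logn 2 n.+1.

Let s_recurrent j K : exists2 n, (K <= n)%N & s n = j.
Proof.
exists (2 ^ j * K.*2.+1).-1.
  rewrite -ltnS prednK ?muln_gt0 ?expn_gt0//.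
  apply: (@leq_trans K.*2.+1); first by rewrite ltnS -addnn leq_addr.
  by rewrite leq_pmull ?expn_gt0.
rewrite /s prednK ?muln_gt0 ?expn_gt0// lognM ?expn_gt0// pfactorK//.
by rewrite logn_coprime ?addn0// prime_coprime// dvdn2/= odd_double.
Qed.

Theorem exists_encoding_function : exists f : X -> R,
  [/\ continuous f, forall x, `|f x| <= 4 &
      forall j, approximable mu f (g j)].
Proof.
pose good n (q : X -> R) := exists N : set (borel X),
  [/\ measurable N, (mu N < (n.+1%:R^-1)%:E)%E &
      forall x, ~ N x -> exists k : int, q x = w n * k%:~R].
have /choice[Q QP] : forall nF : nat * (X -> R), exists q : X -> R,
    continuous nF.2 -> [/\ continuous q, forall x, `|q x - nF.2 x| <= w nF.1 &
      good nF.1 q].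
  move=> [n F]; have [cF|ncF] := pselect (continuous F); last by exists F.
  have [|q [N [cq mN muN qF qk]]] := @quantize F (w n) n.+1%:R^-1 cF (w_gt0 n).
    by rewrite invr_gt0.
  by exists q => _; split => //; exists N; split.
pose F := fix F n : X -> R := if n is m.+1 then
  fun x => Q (m, F m) x + w m / 4 * g (s m) x else cst 0.
have cF n : continuous (F n).
  elim: n => [|n IHn] /=; first by move=> x; exact: cvg_cst.
  have [cq _ _] := QP (n, F n) IHn.
  move=> x; apply: cvgD; first exact: cq.
  by apply: cvgM; [exact: cvg_cst|exact: g_continuous].
have FS n x : `|F n.+1 x - F n x| <= 2 * w n.
  have [_ /(_ x)/= qF _] := QP (n, F n) (cF n).
  rewrite addrAC; apply: le_trans (ler_normD _ _) _.
  have := w_gt0 n; have /andP[g0 g1] := g01 (s n) x.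
  rewrite [X in _ + X]ger0_norm; last by rewrite mulr_ge0 ?divr_ge0 ?(ltW (w_gt0 n)).
  have : w n / 4 * g (s n) x <= w n / 4 * 1.
    by rewrite ler_wpM2l// divr_ge0 ?(ltW (w_gt0 n)).
  by move: qF; lra.
(* The intervals [[lo x n, hi x n]] are nested, and [f x] is a common point. *)
pose lo x n := F n x - 4 * w n; pose hi x n := F n x + 4 * w n.
have lo_mono x : {homo lo x : m n / (m <= n)%N >-> m <= n}.
  apply/nondecreasing_seqP => n; rewrite /lo.
  by have := FS n x; have := wS_half n; rewrite ler_norml => ? /andP[]; lra.
have hi_mono x : {homo hi x : m n / (m <= n)%N >-> n <= m}.
  apply/nonincreasing_seqP => n; rewrite /hi.
  by have := FS n x; have := wS_half n; rewrite ler_norml => ? /andP[]; lra.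
have lo_hi x m n : lo x m <= hi x n.
  apply: (@le_trans _ _ (lo x (maxn m n))); first exact/lo_mono/leq_maxl.
  apply: (@le_trans _ _ (hi x (maxn m n))); last exact/hi_mono/leq_maxr.
  by rewrite /lo /hi; have := w_gt0 (maxn m n); lra.
pose f x := sup (range (lo x)).
have fF n x : `|f x - F n x| <= 4 * w n.
  rewrite ler_distl; apply/andP; split.
    apply: ub_le_sup; last by exists n.
    by exists (hi x 0%N) => _ [m _ <-].
  by apply: ge_sup => [|_ [m _ <-]]; [exists (lo x 0%N); exists 0%N|exact: lo_hi].
have w_small (e : R) : 0 < e -> exists K, forall n, (K <= n)%N -> n.+1%:R^-1 < e.
  move=> e0; exists (Num.trunc e^-1) => n Kn.
  rewrite -[ltRHS]invrK ltf_pV2 ?posrE ?invr_gt0//.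
  by apply: lt_le_trans (truncnS_gt _) _; rewrite ler_nat.
exists f; split.
- move=> x; apply/cvgrPdist_le => e e0.
  have [|K KP] := w_small (e / 12); first by rewrite divr_gt0.
  have wK : w K <= e / 12.
    apply: le_trans (ltW (KP _ (leqnn _))).
    rewrite /w lef_pV2 ?posrE ?ltr0n ?fact_gt0//.
    by rewrite ler_nat factS leq_pmulr ?fact_gt0.
  near=> y.
  have : `|F K x - F K y| <= e / 3.
    by near: y; apply: cvgr_dist_le; [exact: cF|rewrite divr_gt0].
  have := fF K x; have := fF K y; rewrite !ler_norml.
  by move=> /andP[? ?] /andP[? ?] /andP[? ?]; apply/andP; split; lra.
- by move=> x; have := fF 0%N x; rewrite /= subr0 /w invr1 mulr1.
- move=> j e e0.
  (* [d <= 16^-1] keeps the error within the reach of the decoder. *)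
  have [d [d0 de d16]] : exists d : R, [/\ 0 < d, d <= e & d <= 16^-1].
    exists (Num.min e 16^-1).
    by rewrite lt_min e0 !ge_min !lexx orbT invr_gt0 ltr0n.
  have [|K KP] := w_small (d / 16); first by rewrite divr_gt0.
  have [n Kn sn] := s_recurrent j K.
  have [_ _ [N [mN muN qk]]] := QP (n, F n) (cF n).
  exists (@decoder R \o (fun t => (w n)^-1 * t + 0)), N; split => //.
  + exact: is_lipschitz_comp (is_lipschitz_decoder R) (is_lipschitz_affine _ _).
  + apply: lt_le_trans muN _; rewrite lee_fin ltW//.
    apply: lt_le_trans (KP n Kn) _.
    by rewrite ler_pdivrMr//; lra.
  + move=> x /qk[k qE].
    have := fF n.+1 x; rewrite /= qE sn wS.
    have := KP n.+1 (leqW Kn); rewrite ltr_pdivlMr// => nd.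
    set r := f x - _ => rw.
    have fE : (w n)^-1 * f x + 0 = k%:~R + g j x / 4 + r / w n.
      by rewrite /r; field; rewrite gt_eqF.
    have rw4 : `|r / w n| <= 4 * n.+2%:R^-1.
      rewrite normrM normfV (gtr0_norm (w_gt0 n)) ler_pdivrMr//.
      by rewrite -mulrA [_^-1 * _]mulrC.
    move: nd rw4; set u : R := _.+2%:R^-1; clearbody u => nd rw4.
    rewrite fE decoderE ?g01//; last by apply: le_trans rw4 _; lra.
    rewrite addrC addKr normrM ger0_norm//.
    by apply: le_trans (ler_wpM2l _ rw4) _ => //; lra.
Unshelve. all: by end_near. Qed.

End construction.

(** * Regular measures on metric spaces *)

Section metric.
Context (R : realType) (X : pointedMetricType R).

Lemma continuous_mdist (c : X) : continuous (mdist c : X -> R).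
Proof.
move=> x; apply/cvgrPdist_lt => e e0.
near=> y.
have : ball x e y by near: y; exact: nbhsx_ballx.
rewrite ballEmdist/= => xy; rewrite ltr_distl.
have := metric_triangle c x y; have := metric_triangle c y x.
by rewrite (metric_sym y x) => ? ?; apply/andP; split; lra.
Unshelve. all: by end_near. Qed.

Lemma open_mdist_lt (c : X) (r : R) : open [set x | mdist c x < r].
Proof.
have /continuousP := @continuous_mdist c.
by move=> /(_ _ (@interval_open R -oo%O (BLeft r) isT isT)).
Qed.

Lemma compact_finite_net (K : set X) (r : R) : compact K -> 0 < r ->
  exists s : seq X, forall x, K x -> exists2 c, c \in s & mdist c x < r.
Proof.
rewrite compact_cover => cK r0.
have [|x Kx|D _ KD] := cK X K (fun c => [set x | mdist c x < r]).
- by move=> c _; exact: open_mdist_lt.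
- by exists x => //=; rewrite mdistxx.
- by exists (finmap.enum_fset D) => x /KD[c /= cD cx]; exists c.
Qed.

Variable mu : {finite_measure set (borel X) -> \bar R}.
Hypothesis mu_regular : regular_measure mu.

Lemma compact_measurable_borel (K : set X) :
  compact K -> measurable (K : set (borel X)).
Proof.
move=> cK; rewrite -[K]setCK; apply: measurableC.
apply: open_measurable_borel; apply: closed_openC.
by apply: compact_closed => //; exact: metric_hausdorff.
Qed.

Lemma regular_measure_tight (e : R) : 0 < e ->
  exists2 K : set X, compact K & (mu (~` K : set (borel X)) < e%:E)%E.
Proof.
move=> e0; have [muT _] := mu_regular measurableT.
have muTfin : mu setT \is a fin_num by exact: fin_num_measure.
have : (mu setT - e%:E < mu setT)%E by rewrite lteBlDr// lteDl ?lte_fin.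
rewrite {2}muT => /ereal_sup_gt[_ [K [cK _] <-]] muK.
exists K => //; have mK := compact_measurable_borel cK.
rewrite -setTD measureD ?setTI//; last by rewrite ltey_eq muTfin.
by rewrite lteBlDl ?fin_num_measure// -lteBlDr.
Qed.

(** Countably many balls suffice to exhaust every open set up to a null set,
    although [X] itself need not be separable: the measure is carried by a
    countable union of compact sets, each of which has finite nets. *)
Lemma countable_ball_cover : exists (c : nat -> X) (r : nat -> R),
  (forall a, r a <= 1) /\ forall U : set X, open U ->
    mu ((U `\` \bigcup_(a in [set a | [set x | mdist (c a) x < r a] `<=` U])
               [set x | mdist (c a) x < r a]) : set (borel X)) = 0%E.
Proof.
have /choice[K KP] n : exists K : set X,
    compact K /\ (mu (~` K : set (borel X)) < (n.+1%:R^-1)%:E)%E.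
  by have [|K cK muK] := @regular_measure_tight n.+1%:R^-1;
    [rewrite invr_gt0|exists K].
have /choice[net netP] (nm : nat * nat) : exists s : seq X,
    forall x, K nm.1 x -> exists2 c, c \in s & mdist c x < nm.2.+1%:R^-1.
  by apply: compact_finite_net; [exact: (KP _).1|rewrite invr_gt0].
pose ix a : nat * nat * nat := odflt (0, 0, 0)%N (unpickle a).
pose c a := nth point (net (ix a).1) (ix a).2.
pose r a : R := (ix a).1.2.+1%:R^-1.
exists c, r; split=> [a|U oU].
  by rewrite invf_le1// ler1n.
set V := \bigcup_(a in _) _.
have mV : measurable (U `\` V : set (borel X)).
  apply: measurableD; first exact: open_measurable_borel.
  apply: open_measurable_borel; apply: bigcup_open => a _.
  exact: open_mdist_lt.
(* A point of [U] in [K n] lies in a ball of the family contained in [U]: take a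
   net of [K n] that is fine with respect to the distance to [~` U]. *)
have UK n : U `\` V `<=` ~` K n.
  move=> x [Ux Vx] Kx; apply: Vx.
  have := open_nbhs_nbhs (conj oU Ux); rewrite -nbhs_ballE => -[e /= e0 eU].
  pose m := Num.trunc (2 / e).
  have : m.+1%:R^-1 < (2 / e)^-1.
    by rewrite ltf_pV2 ?posrE ?divr_gt0// truncnS_gt.
  rewrite invf_div => me.
  have [y ynet yx] := netP (n, m) x Kx.
  pose a := pickle ((n, m), index y (net (n, m))).
  have ra : r a = m.+1%:R^-1 by rewrite /r /ix pickleK.
  have ca : c a = y by rewrite /c /ix pickleK/= nth_index.
  exists a; rewrite /= ra ca// => z /= yz.
  apply: eU; rewrite ballEmdist/=.
  apply: le_lt_trans (metric_triangle _ y _) _.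
  by rewrite metric_sym; move: me yx yz; set u := _^-1; lra.
apply/eqP; rewrite -measure_le0; apply/lee_addgt0Pr => e e0; rewrite add0e.
have /= ne : (Num.trunc e^-1).+1%:R^-1 < e.
  by rewrite -[ltRHS]invrK ltf_pV2 ?posrE ?invr_gt0// truncnS_gt.
have [cK /ltW muK] := KP (Num.trunc e^-1).
apply: (@le_trans _ _ (mu (~` K (Num.trunc e^-1) : set (borel X)))).
  apply: (le_measure mu _ _ (UK _)); rewrite inE//.
  by apply: measurableC; exact: compact_measurable_borel.
by apply: le_trans muK _; rewrite lee_fin ltW.
Qed.

Theorem exists_generating_function : exists f : X -> R,
  [/\ continuous f, forall x, `|f x| <= 4 &
      forall E : set (borel X), measurable E -> approximable mu f \1_E].
Proof.
have [c [r [r1 cover]]] := countable_ball_cover.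
(* The truncation at [1] leaves the balls unchanged, since [r a <= 1]. *)
pose g a x : R := Num.min 1 (mdist (c a) x).
have cg a : continuous (g a).
  move=> x; apply: continuous_min; first exact: cvg_cst.
  exact: continuous_mdist.
have [|f [cf f4 af]] := exists_encoding_function mu cg.
  by move=> a x; rewrite /g le_min ler01 mdist_ge0 ge_min lexx.
exists f; split => // E mE; suff [] : approximable_set mu f E by [].
move: E mE; apply: smallest_sub; first exact: sigma_algebra_approximable_set.
move=> U oU; split; first exact: open_measurable_borel.
have [sig0 _ sigU] := sigma_algebra_approximable_set mu f.
pose ball_ a : set (borel X) := [set x | mdist (c a) x < r a].
have aball a : approximable_set mu f (ball_ a).
  split; first by apply: open_measurable_borel; exact: open_mdist_lt.
  have -> : ball_ a = [set x | g a x < r a].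
    by apply/seteqP; split=> x; rewrite /ball_ /g /= gt_min// ltNge r1.
  apply: approximable_indic_lt => //.
  exact: continuous_measurable_borel.
pose V := \bigcup_(a in [set a | ball_ a `<=` U]) ball_ a.
have [mV aV] : approximable_set mu f V.
  rewrite /V bigcup_mkcond; apply: sigU => a.
  by case: ifP.
apply: approximable_limit => e e0.
exists \1_V, (U `\` V); split => //.
- by apply: measurableD => //; exact: open_measurable_borel.
- by rewrite [X in (X < _)%E](cover U oU) lte_fin.
- move=> x nx; rewrite !indicE.
  suff -> : (x \in V) = (x \in U) by rewrite subrr normr0 ltW.
  apply/idP/idP; rewrite !inE; first by move=> [a /= aU /aU].
  by move=> Ux; apply: contrapT => Vx; exact: nx.
Qed.

End metric.

(** * Density of polynomials in L^p *)

Section Lp_density_real.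
Context d (T : measurableType d) (R : realType).
Variable mu : {finite_measure set T -> \bar R}.
Variable p : R.
Hypothesis p1 : 1 <= p.
Implicit Types (h a : T -> R).

Let p0 : 0 < p. Proof. exact: lt_le_trans p1. Qed.

Lemma Lnorm_lt h (e : R) : 0 < e ->
  (\int[mu]_x (`|h x| `^ p)%:E < (e `^ p)%:E)%E ->
  ('N[mu]_p%:E[EFin \o h] < e%:E)%E.
Proof.
move=> e0; rewrite !ltNge; apply: contraNN => eN.
rewrite -poweR_EFin.
have -> : (\int[mu]_x (`|h x| `^ p)%:E = 'N[mu]_p%:E[EFin \o h] `^ p)%E.
  by rewrite poweR_Lnorm ?gt_eqF.
by apply: gt0_ler_poweR; rewrite ?(ltW p0) ?in_itv/= ?leey ?andbT ?Lnorm_ge0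
  ?lee_fin ?(ltW e0).
Qed.

Let measurable_powR_norm h : measurable_fun setT h ->
  measurable_fun setT (fun x => (`|h x| `^ p)%:E).
Proof.
move=> mh; apply/measurable_EFinP.
apply: (measurableT_comp (measurable_powR p)).
exact: measurableT_comp.
Qed.

Lemma Lnorm_truncation a (e : R) : measurable_fun setT a ->
  ('N[mu]_p%:E[EFin \o a] < +oo)%E -> 0 < e ->
  exists2 M : R, 0 <= M &
    ('N[mu]_p%:E[EFin \o (fun x => a x - clamp (- M) M (a x))%R] < e%:E)%E.
Proof.
move=> ma aoo e0.
pose u n x := a x - clamp (- n%:R) n%:R (a x).
have mun n : measurable_fun setT (u n).
  apply: measurable_funB => //; apply: measurableT_comp ma.
  apply: continuous_measurable_fun; apply: is_lipschitz_continuous.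
  exact: is_lipschitz_clamp.
have ia : mu.-integrable setT (fun x => (`|a x| `^ p)%:E).
  apply/integrableP; split; first exact: measurable_powR_norm.
  rewrite (eq_integral (fun x => (`|a x| `^ p)%:E)) => [|x _]; last first.
    by rewrite gee0_abs// lee_fin powR_ge0.
  have -> : (\int[mu]_x (`|a x| `^ p)%:E = 'N[mu]_p%:E[EFin \o a] `^ p)%E.
    by rewrite poweR_Lnorm ?gt_eqF.
  by rewrite poweR_lty.
have := @dominated_convergence _ _ _ mu setT measurableT
  (fun n x => (`|u n x| `^ p)%:E) (cst 0%E) _
  (fun n => measurable_powR_norm (mun n))
  (measurable_cst _) _ ia _.
case.
- apply/aeW => x _; apply: cvg_near_cst; near=> n.
  have an : `|a x| <= n%:R by near: n; exact: nbhs_infty_ger.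
  by rewrite /u clamp_id -?ler_norml// subrr normr0 powR0 ?gt_eqF.
- apply/aeW => x n _; rewrite /= lee_fin ger0_norm ?powR_ge0//.
  apply: ge0_ler_powR; rewrite ?nnegrE ?(ltW p0)//.
  exact: clamp_remainder.
- move=> _ _; rewrite integral0 => /(_ [set y | y < (e `^ p)%:E]%E)[].
    apply: open_nbhs_nbhs; split; first exact: open_ereal_lt_ereal.
    by rewrite /= lte_fin powR_gt0.
  move=> n _ /(_ n (leqnn n))/= un.
  by exists n%:R => //; exact: Lnorm_lt.
Unshelve. all: by end_near. Qed.

Variables (f : T -> R) (B : R).
Hypotheses (mf : measurable_fun setT f) (fB : forall x, `|f x| <= B).
Hypothesis af : forall E, measurable E -> approximable mu f \1_E.

Let measurable_horner (P : {poly R}) : measurable_fun setT (fun x => P.[f x]).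
Proof.
apply: measurableT_comp mf; apply: continuous_measurable_fun.
exact: continuous_horner.
Qed.

(** Clamping [phi] to [[- M, M]] keeps the error below [2 * M + 1] on the
    exceptional set, so its contribution to the integral is small for every
    exponent. *)
Lemma Lnorm_polynomial_bounded a (M e : R) : measurable_fun setT a ->
  (forall x, `|a x| <= M) -> 0 < e -> exists P : {poly R},
    ('N[mu]_p%:E[EFin \o (fun x => a x - P.[f x])%R] < e%:E)%E.
Proof.
move=> ma aM e0.
have M0 : 0 <= M by apply: le_trans (aM point).
pose m := fine (mu setT).
have mE : mu setT = m%:E by rewrite fineK ?fin_num_measure.
have m0 : 0 <= m by rewrite fine_ge0.
pose C := (2 * M + 1) `^ p.
have C0 : 0 <= C by rewrite powR_ge0.
have ep0 : 0 < e `^ p by rewrite powR_gt0.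
(* The estimate below is [(2 * r) `^ p * m + C * r], and [(2 * r) `^ p <= 2 * r]
   when [r <= 2^-1]. *)
have [r [r0 r2 re]] : exists r : R,
    [/\ 0 < r, r <= 2^-1 & (2 * r) * m + C * r < e `^ p].
  exists (Num.min 2^-1 (e `^ p / (2 * m + C + 1))).
  have D0 : 0 < 2 * m + C + 1 by lra.
  rewrite lt_min invr_gt0 ltr0n divr_gt0// ge_min lexx; split => //.
  have rle : Num.min 2^-1 (e `^ p / (2 * m + C + 1)) <= e `^ p / (2 * m + C + 1).
    by rewrite ge_min lexx orbT.
  move: rle; set r := Num.min _ _; rewrite ler_pdivlMr// => rle.
  have : 0 < r by rewrite lt_min invr_gt0 ltr0n divr_gt0.
  by nra.
have [phi [N [lphi mN muN phia]]] := approximable_bounded af ma aM r0.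
have B0 : 0 < `|B| + 1 by rewrite ltr_wpDl.
have [P PE] :=
  weierstrass (is_lipschitz_comp (is_lipschitz_clamp (- M) M) lphi) B0 r0.
have clampa x : clamp (- M) M (a x) = a x
  by apply: clamp_id; rewrite -ler_norml.
have Pf x : `|P.[f x] - clamp (- M) M (phi (f x))| <= r.
  by apply: PE; apply: le_trans (fB x) _; apply: le_trans (ler_norm _) _;
    rewrite lerDl.
have good x : ~ N x -> `|a x - P.[f x]| <= 2 * r.
  move=> Nx; have := Pf x; have := clamp_dist (- M) M (phi (f x)) (a x).
  have := phia x Nx; rewrite clampa => h1 h2 h3.
  rewrite distrC; apply: le_trans (ler_distD (clamp (- M) M (phi (f x))) _ _) _.
  lra.
have bad x : `|a x - P.[f x]| <= 2 * M + 1.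
  have MM : - M <= M by lra.
  have /andP[c1 c2] := clamp_itv (phi (f x)) MM.
  have := Pf x; have := aM x; rewrite !ler_norml => /andP[? ?] /andP[? ?].
  by apply/andP; split; lra.
exists P; apply: Lnorm_lt => //.
have mh : measurable_fun setT (fun x => a x - P.[f x]) by exact: measurable_funB.
apply: (@le_lt_trans _ _ (\int[mu]_x ((2 * r)%:E + C%:E * (\1_N x)%:E))%E).
  apply: ge0_le_integral => //.
  - exact: measurable_powR_norm.
  - apply: emeasurable_funD; first exact: measurable_cst.
    apply: emeasurable_funM; first exact: measurable_cst.
    exact/measurable_EFinP/measurable_indic.
  - move=> x _; rewrite -EFinM -EFinD lee_fin indicE.
    have [Nx|Nx] := pselect (N x).
      rewrite mem_set// mulr1 ler_wpDl ?mulr_ge0 ?(ltW r0)//.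
      apply: ge0_ler_powR; rewrite ?nnegrE ?(ltW p0)//; lra.
    rewrite memNset// mulr0 addr0.
    apply: (@le_trans _ _ ((2 * r) `^ p)).
      apply: ge0_ler_powR; rewrite ?nnegrE ?(ltW p0)//; first lra.
      exact: good.
    by apply: ge1r_powR => //; apply/andP; split; lra.
rewrite ge0_integralD//; last 3 first.
- by move=> x _; rewrite lee_fin; lra.
- by move=> x _; rewrite mule_ge0// lee_fin.
- apply: emeasurable_funM; first exact: measurable_cst.
  exact/measurable_EFinP/measurable_indic.
have -> : (\int[mu]_x (2 * r)%:E = (2 * r * m)%:E)%E.
  by rewrite integral_cst// (EFinM (2 * r) m) -mE.
rewrite ge0_integralZl//; last exact/measurable_EFinP/measurable_indic.
rewrite integral_indic// setIT.
apply: (@le_lt_trans _ _ ((2 * r * m)%:E + C%:E * r%:E)%E).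
  by apply: leeD2l; apply: lee_wpmul2l; rewrite ?lee_fin// ltW.
by rewrite -EFinM -EFinD lte_fin.
Qed.

Lemma Lnorm_polynomial a (e : R) : measurable_fun setT a ->
  ('N[mu]_p%:E[EFin \o a] < +oo)%E -> 0 < e -> exists P : {poly R},
    ('N[mu]_p%:E[EFin \o (fun x => a x - P.[f x])%R] < e%:E)%E.
Proof.
move=> ma aoo e0; have e20 : 0 < e / 2 by rewrite divr_gt0.
have [M M0 aM] := Lnorm_truncation ma aoo e20.
pose b x := clamp (- M) M (a x).
have mb : measurable_fun setT b.
  apply: measurableT_comp ma; apply: continuous_measurable_fun.
  by apply: is_lipschitz_continuous; exact: is_lipschitz_clamp.
have bM x : `|b x| <= M by rewrite ler_norml clamp_itv//; lra.
have [P bP] := Lnorm_polynomial_bounded mb bM e20.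
exists P.
have -> : (fun x => a x - P.[f x]) =
    (fun x => a x - b x) \+ (fun x => b x - P.[f x]).
  by apply/funext => x /=; rewrite addrA subrK.
apply: le_lt_trans (minkowski_EFin mu _ _ p1) _; [exact: measurable_funB..|].
by rewrite [e]splitr EFinD lteD.
Qed.

End Lp_density_real.

Section Lp_density_complex.
Context d (T : measurableType d) (R : realType).
Variable mu : {finite_measure set T -> \bar R}.
Variables (p : R) (p1 : 1 <= p).

Lemma horner_complex (A B : {poly R}) (t : R) :
  (map_poly (real_complex R) A +
   ('i)%C%:P * map_poly (real_complex R) B).[(t%:C)%C] = (A.[t] +i* B.[t])%C.
Proof.
rewrite hornerD hornerM hornerC !horner_map/=.
by apply/eqP; rewrite eq_complex /=; apply/andP; split; apply/eqP; ring.
Qed.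

Lemma normc_le (z : R[i]) : Normc.normc z <= `|complex.Re z| + `|complex.Im z|.
Proof.
case: z => a b /=; rewrite -[leRHS]ger0_norm ?addr_ge0// -sqrtr_sqr.
rewrite ler_wsqrtr// sqrrD !real_normK ?num_real//.
by rewrite -addrA lerD2l lerDr mulrn_wge0// mulr_ge0.
Qed.

Lemma Re_le_normc (z : R[i]) : `|complex.Re z| <= Normc.normc z.
Proof. by case: z => a b /=; rewrite -sqrtr_sqr ler_wsqrtr// lerDl sqr_ge0. Qed.

Lemma Im_le_normc (z : R[i]) : `|complex.Im z| <= Normc.normc z.
Proof. by case: z => a b /=; rewrite -sqrtr_sqr ler_wsqrtr// lerDr sqr_ge0. Qed.

Lemma measurable_normc (u : T -> R[i]) : measurable_fun setT u ->
  measurable_fun setT (fun x => Normc.normc (u x)).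
Proof.
move=> meas_u;
have := measurable_normc_sub meas_u (@measurable_cst _ _ _ R[i] setT 0).
by congr (measurable_fun _ _); apply/funext => x; rewrite subr0.
Qed.

Lemma ae_eq_Lp_edist (u v w : T -> R[i]) : measurable_fun setT u ->
  measurable_fun setT v -> measurable_fun setT w ->
  v = w %[ae mu] -> Lp_edist mu p u v = Lp_edist mu p u w.
Proof.
move=> meas_u mv mw vw; rewrite /Lp_edist unlock; congr (_ `^ _)%E.
have mpow (h : T -> R[i]) : measurable_fun setT h ->
    measurable_fun setT (fun x => (`|(Normc.normc (u x - h x))%:E| `^ p)%E).
  move=> mh; apply: (measurableT_comp (measurable_poweR _)).
  by apply: measurableT_comp => //; exact/measurable_EFinP/measurable_normc_sub.
apply: ge0_ae_eq_integral => //; [exact: mpow|exact: mpow|..].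
- by move=> x _; exact: poweR_ge0.
- by move=> x _; exact: poweR_ge0.
by apply: filterS vw => x /= /[apply] ->.
Qed.

(** A measurable function at finite distance from an element of [L^p] has its
    class in [L^p]. *)
Lemma complexLp_of_fun (u : complexLp mu p1) (v : T -> R[i]) :
  measurable_fun setT v -> (Lp_edist mu p u v < +oo)%E ->
  exists2 V : complexLp mu p1, (V : T -> R[i]) = v %[ae mu] &
    Lp_edist mu p u V = Lp_edist mu p u v.
Proof.
move=> mv uv.
pose v' := mfun_Sub (mem_set mv : v \in mfun).
pose q : {mfun_ mu, T >-> R[i]} := (\pi_({mfun_ mu, T >-> R[i]}) v')%qT.
have qv : (q : T -> R[i]) = v %[ae mu].
  have /eqmodP/asboolP : (repr q = v' %[mod {mfun_ mu, T >-> R[i]}])%qT.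
    by rewrite reprK.
  by [].
have meas_u : measurable_fun setT (u : T -> R[i]) by exact: measurable_funPT.
have mq : measurable_fun setT (q : T -> R[i]) by exact: measurable_funPT.
have uq := ae_eq_Lp_edist meas_u mq mv qv.
have fin_q : `[< ('N[mu]_p%:E[(fun x => (Normc.normc (q x))%:E)] < +oo)%E >].
  apply/asboolP.
  have m0 := @measurable_cst _ _ T R[i] setT 0.
  have -> : ('N[mu]_p%:E[(fun x => (Normc.normc (q x))%:E)] =
      Lp_edist mu p q (cst (0 : R[i])%R))%E.
    by apply: eq_Lnorm => x; rewrite subr0.
  apply: le_lt_trans (Lp_edist_triangle mu p1 mq meas_u m0) _.
  rewrite lte_add_pinfty// ?(Lp_edist_sym _ _ q) ?uq//.
  have /asboolP := complexLp_finite u.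
  by congr (_ < _)%E; apply: eq_Lnorm => x; rewrite subr0.
by exists (ComplexLp p1 fin_q).
Qed.

Variables (f : T -> R) (B : R).
Hypotheses (mf : measurable_fun setT f) (fB : forall x, `|f x| <= B).
Hypothesis af : forall E, measurable E -> approximable mu f \1_E.

Lemma dense_polynomials_in : dense (polynomials_in mu p1 f).
Proof.
move=> O [u Ou] oO.
have := open_nbhs_nbhs (conj oO Ou); rewrite -nbhs_ballE => -[e /= e0 eO].
have e20 : 0 < e / 2 by rewrite divr_gt0.
have p0 : 0 < p by exact: lt_le_trans p1.
have meas_u : measurable_fun setT (u : T -> R[i]) by exact: measurable_funPT.
have /measurable_complexP[mre mim] := meas_u.
have /asboolP unorm := complexLp_finite u.
have part_lty (c : T -> R) : measurable_fun setT c ->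
    (forall x, `|c x| <= Normc.normc (u x)) ->
    ('N[mu]_p%:E[EFin \o c] < +oo)%E.
  move=> mc cu; apply: le_lt_trans unorm.
  rewrite -Lnorm_abse; apply: (@le_Lnorm _ _ _ mu p (fun x => `|c x|)) => //.
  - exact: measurableT_comp.
  - exact: measurable_normc.
  - by move=> x; rewrite normr_ge0 cu.
have [A uA] := Lnorm_polynomial p1 mf fB af mre
  (part_lty _ mre (fun x => Re_le_normc _)) e20.
have [C uC] := Lnorm_polynomial p1 mf fB af mim
  (part_lty _ mim (fun x => Im_le_normc _)) e20.
pose P := map_poly (real_complex R) A + ('i)%C%:P * map_poly (real_complex R) C.
pose v x := P.[((f x)%:C)%C].
have vE x : v x = (A.[f x] +i* C.[f x])%C by exact: horner_complex.
have mpoly (Q : {poly R}) : measurable_fun setT (fun x => Q.[f x]).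
  apply: measurableT_comp mf; apply: continuous_measurable_fun.
  exact: continuous_horner.
have mv : measurable_fun setT v.
  by apply/measurable_complexP; split; under eq_fun do rewrite vE/=; exact: mpoly.
have mA : measurable_fun setT (fun x => complex.Re (u x) - A.[f x]).
  exact: measurable_funB.
have mC : measurable_fun setT (fun x => complex.Im (u x) - C.[f x]).
  exact: measurable_funB.
have ReB (z w : R[i]) : complex.Re (z - w) = complex.Re z - complex.Re w.
  by case: z; case: w.
have ImB (z w : R[i]) : complex.Im (z - w) = complex.Im z - complex.Im w.
  by case: z; case: w.
have uv : (Lp_edist mu p u v < e%:E)%E.
  apply: (@le_lt_trans _ _ ('N[mu]_p%:E[EFin \o
    ((fun x => `|complex.Re (u x) - A.[f x]|) \+
     (fun x => `|complex.Im (u x) - C.[f x]|))%R])%E).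
    apply: le_Lnorm => //.
    - exact: measurable_normc_sub.
    - by apply: measurable_funD; exact: measurableT_comp.
    - move=> x; apply/andP; split; first by case: (_ - _) => *; exact: sqrtr_ge0.
      by apply: le_trans (normc_le _) _; rewrite vE ReB ImB.
  apply: le_lt_trans (minkowski_EFin mu _ _ p1) _.
  - exact: measurableT_comp.
  - exact: measurableT_comp.
  rewrite [e]splitr EFinD lteD//.
  - by rewrite -Lnorm_abse in uA.
  - by rewrite -Lnorm_abse in uC.
have [V Vv uV] := complexLp_of_fun mv (lt_trans uv (ltry e)).
exists V; split.
  apply: eO; rewrite ballEmdist/= -lte_fin.
  rewrite fineK ?ge0_fin_numE ?Lnorm_ge0 ?Lp_edist_lty//.
  by rewrite uV.
exists P; apply: filterS Vv => x /= Vx; exact: Vx.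
Qed.

End Lp_density_complex.

Theorem theorem1p3 (R : realType) (X : pointedMetricType R)
    (mu : {finite_measure set (borel X) -> \bar R}) :
  regular_measure mu ->
  exists f : X -> R,
    [/\ continuous f,
        [bounded f x | x in [set: X]]
      & forall (p : R) (p1 : 1 <= p), dense (polynomials_in mu p1 f)].
Proof.
move=> /exists_generating_function[f [cf f4 af]]; exists f; split => //.
  by exists 4; split => // M M4 x _; apply: le_trans (f4 x) _; exact: ltW.
move=> p p1; exact: (@dense_polynomials_in _ (borel X) R mu p p1 f 4
  (continuous_measurable_borel cf) f4 af).
Qed.
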